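(* Let $d\ge 1$ be an integer and let $p=(p_0,\dots,p_d)\in\mathcal{D}_d$. Then the class $\mathcal{P}(p)=\{f\in\mathcal{F}_d : p_f=p\}$ is the convex polytope $$\mathcal{P}(p)=\prod_{k=0}^d \Delta_{n_k,\sqrt{2}p_k},\qquad n_k=\binom{d}{k}-1,$$ (under the identification of $\mathbb{R}^{2^d}=\mathbb{R}^{\mathcal{X}}$ with $\prod_{k=0}^d\mathbb{R}^{\mathcal{X}_k}$), and its extremal points are exactly the functions $$f^{\sigma}(x)=\begin{cases} p_k & \text{if } x=x_k^{\sigma_k} \text{ for some } k\in\{0,\dots,d\},\\ 0 & \text{otherwise,}\end{cases}$$ where $\sigma=(\sigma_0,\dots,\sigma_d)$ ranges over all tuples with $\sigma_k\in\{1,\dots,\binom{d}{k}\}$, $k=0,\dots,d$.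
   Context: $\mathcal{X}=\{0,1\}^d$. $\mathcal{F}_d\subset\mathbb{R}^{2^d}$ is the simplex of probability mass functions $f=(f(x))_{x\in\mathcal{X}}$ on $\mathcal{X}$. $\mathcal{D}_d\subset\mathbb{R}^{d+1}$ is the simplex of probability mass functions $p=(p_0,\dots,p_d)$ on $\{0,\dots,d\}$. For $f\in\mathcal{F}_d$, $p_f\in\mathcal{D}_d$ denotes the probability mass function of $\sum_{i=1}^d X_i$ when $(X_1,\dots,X_d)$ has probability mass function $f$. For $k=0,\dots,d$, $\mathcal{X}_k=\{x\in\mathcal{X}:\sum_i x_i=k\}$, a set with $\binom{d}{k}$ elements, and $x_k^1,\dots,x_k^{\binom{d}{k}}$ is a fixed enumeration of $\mathcal{X}_k$ (the one inherited from the reverse-lexicographic order of $\mathcal{X}$). For an integer $n\ge0$ and real $q\ge0$, $\Delta_{n,\sqrt{2}q}=\{y\in\mathbb{R}^{n+1}: y_j\ge0,\ j=0,\dots,n,\ \sum_{h=0}^n y_h=q\}$ (the $n$-simplex with side $\sqrt{2}q$). *)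

(* Defs.v *)
From HB Require Import structures.
From mathcomp Require Import all_boot all_order all_algebra.
From mathcomp Require Import boolp classical_sets cardinality reals.

Set Implicit Arguments.
Unset Strict Implicit.
Unset Printing Implicit Defensive.

Import Order.TTheory GRing.Theory Num.Theory.

Local Open Scope classical_set_scope.
Local Open Scope ring_scope.

Section Convexity.
Context {R : realType} {E : lmodType R}.

Definition conv_hull (A : set E) : set E :=
  [set z | exists (m : nat) (v : 'I_m -> E) (t : 'I_m -> R),
     [/\ forall i, A (v i), forall i, 0 <= t i, \sum_(i < m) t i = 1
       & z = \sum_(i < m) t i *: v i]].

Definition convex_polytope (A : set E) : Prop :=
  exists2 V : set E, finite_set V & A = conv_hull V.

Definition extremal_points (A : set E) : set E :=
  [set z | A z /\ forall (x y : E) (t : R), A x -> A y -> 0 < t < 1 ->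
     z = t *: x + (1 - t) *: y -> x = z /\ y = z].

End Convexity.

(* Probability mass functions on a finite type T, as a subset of R^T; R^o makes
   {ffun T -> R^o} a module over R. *)
Definition pmfs (R : realType) (T : finType) : set {ffun T -> R^o} :=
  [set f | (forall x, 0 <= f x) /\ \sum_x f x = 1].

(* The vertices of this n-simplex are the q *: e_j, so its side is sqrt 2 * q. *)
Definition simplex (R : realType) (n : nat) (q : R) : set 'rV[R]_n.+1 :=
  [set y | (forall j, 0 <= y 0 j) /\ \sum_j y 0 j = q].

Definition binvec (d : nat) : finType := d.-tuple bool.

Definition weight (d : nat) (x : binvec d) : nat := \sum_(i < d) tnth x i.

Definition sum_law (R : realType) (d : nat) (f : {ffun binvec d -> R^o}) :
    {ffun 'I_d.+1 -> R^o} :=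
  [ffun k : 'I_d.+1 => \sum_(x | weight x == k) f x].

Definition pmfs_with_sum (R : realType) (d : nat) (p : {ffun 'I_d.+1 -> R^o}) :
    set {ffun binvec d -> R^o} :=
  [set f | pmfs f /\ sum_law f = p].

(* The last coordinate is the most significant one: 00, 10, 01, 11 for d = 2. *)
Definition revlex (d : nat) : rel (binvec d) :=
  fun x y => ((rev x : seqlexi bool) <= (rev y : seqlexi bool))%O.

Definition level_seq (d k : nat) : seq (binvec d) :=
  sort (@revlex d) (enum [set x : binvec d | weight x == k]%SET).

(* x_k^(j+1): indices start at 0; the default value is never reached when
   j < 'C(d, k), see size_level_seq. *)
Definition level_pt (d k j : nat) : binvec d :=
  nth (nseq_tuple d false) (level_seq d k) j.

Definition blocks (R : realType) (d : nat) (f : {ffun binvec d -> R^o}) :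
    forall k : 'I_d.+1, 'rV[R]_('C(d, k).-1.+1) :=
  fun k => \row_(j < 'C(d, k).-1.+1) f (level_pt d k j).

Definition simplex_prod (R : realType) (d : nat) (p : {ffun 'I_d.+1 -> R^o}) :
    set (forall k : 'I_d.+1, 'rV[R]_('C(d, k).-1.+1)) :=
  [set y | forall k, simplex (p k) (y k)].

(* At most one k satisfies the test: level_pt d k (s k) has weight k. *)
Definition extremal_pmf (R : realType) (d : nat) (p : {ffun 'I_d.+1 -> R^o})
    (s : forall k : 'I_d.+1, 'I_('C(d, k))) : {ffun binvec d -> R^o} :=
  [ffun x => if [pick k : 'I_d.+1 | x == level_pt d k (s k)] is Some k
             then p k else 0].

Lemma size_level_seq d k : size (level_seq d k) = 'C(d, k).
Proof.
rewrite size_sort -cardE.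
pose g (x : binvec d) : {set 'I_d} := [set i | tnth x i]%SET.
have g_inj : injective g.
  move=> x y /setP exy; apply: eq_from_tnth => i.
  by have := exy i; rewrite !inE.
have wg x : weight x = #|g x|.
  rewrite -sum1_card big_mkcond /=; apply: eq_bigr => i _.
  by rewrite inE; case: (tnth x i).
rewrite -[d in 'C(d, _)]card_ord -card_draws -(card_imset _ g_inj).
apply: eq_card => A; rewrite inE; apply/imsetP/idP => [[x + ->]|/eqP cA].
  by rewrite inE wg.
have gA : g [tuple i \in A | i < d] = A.
  by apply/setP => i; rewrite inE tnth_mktuple.
by exists [tuple i \in A | i < d]; rewrite ?inE ?wg gA ?cA.
Qed.

Lemma mem_level_seq d k x : (x \in level_seq d k) = (weight x == k).
Proof. by rewrite mem_sort mem_enum inE. Qed.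

Lemma uniq_level_seq d k : uniq (level_seq d k).
Proof. by rewrite sort_uniq enum_uniq. Qed.

Lemma weight_leq d (x : binvec d) : (weight x <= d)%N.
Proof.
rewrite -[leqRHS]card_ord -sum1_card; apply: leq_sum => i _.
exact: leq_b1.
Qed.

Lemma bin_predK d (k : 'I_d.+1) : 'C(d, k).-1.+1 = 'C(d, k).
Proof. by rewrite prednK // bin_gt0 -ltnS. Qed.

(* blocks is a linear isomorphism, so it identifies R^X with the product of the
   R^(X_k). *)
Lemma blocks_bij (R : realType) d : bijective (@blocks R d).
Proof.
pose pos x := index x (level_seq d (weight x)).
pose g (y : forall k : 'I_d.+1, 'rV[R]_('C(d, k).-1.+1)) :=
  [ffun x : binvec d => y (inord (weight x)) 0 (inord (pos x)) : R^o].
have wK (x : binvec d) : (inord (weight x) : 'I_d.+1) = weight x :> nat.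
  by rewrite inordK // ltnS weight_leq.
exists g => [f|y].
  apply/ffunP => x; rewrite ffunE mxE; congr (f _).
  have lt_pos : (pos x < 'C(d, weight x))%N.
    by rewrite -size_level_seq index_mem mem_level_seq.
  rewrite /level_pt [X in nth _ _ X]inordK; last by rewrite bin_predK wK.
  by rewrite wK nth_index // mem_level_seq.
apply: functional_extensionality_dep => k; apply/rowP => j; rewrite mxE ffunE.
have lt_j : (j < size (level_seq d k))%N.
  by rewrite size_level_seq -[X in (_ < X)%N]bin_predK ltn_ord.
have wj : weight (level_pt d k j) = k.
  by apply/eqP; rewrite -mem_level_seq mem_nth.
have -> : pos (level_pt d k j) = j.
  by rewrite /pos wj index_uniq // uniq_level_seq.
by rewrite wj inord_val inord_val.
Qed.

Lemma blocks_linear (R : realType) d (a : R) (f g : {ffun binvec d -> R^o}) k :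
  blocks (a *: f + g) k = a *: blocks f k + blocks g k.
Proof. by apply/rowP => j; rewrite !mxE !ffunE. Qed.

(* Main.v *)
(** Membership in P(p) only constrains f on each level X_k separately, which
    gives the product of simplices.  A selection of one point in every level
    yields a vertex, and f is the convex combination of the vertices in which
    the points of the different levels are selected independently, x in X_k
    having probability f(x) / p_k.  An extremal point of the hull of V lies in
    V, and a vertex is extremal because its zero entries and the level sums
    determine it. *)
Require Import Defs.
From HB Require Import structures.
From mathcomp Require Import all_boot all_order all_algebra.
From mathcomp Require Import boolp classical_sets cardinality reals.

Import Order.TTheory GRing.Theory Num.Theory.

Local Open Scope classical_set_scope.
Local Open Scope ring_scope.

(** * Convex combinations and extremal points of a hull *)

Section ConvexHull.
Context {R : realType} {E : lmodType R}.

(** Frees convex combinations from ordinal indices; they are indexed below by [predC1 i] and by the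
    selections. *)
Lemma conv_hull_fin (A : set E) (I : finType) (Q : {pred I}) (v : I -> E)
    (t : I -> R) :
  {in Q, forall i, A (v i)} -> {in Q, forall i, 0 <= t i} ->
  \sum_(i in Q) t i = 1 -> conv_hull A (\sum_(i in Q) t i *: v i).
Proof.
move=> vA t0 t1; exists #|Q|, (v \o enum_val), (t \o enum_val); split.
- by move=> i; apply: vA; apply: enum_valP.
- by move=> i; apply: t0; apply: enum_valP.
- by rewrite -t1 [RHS]big_enum_val.
- by rewrite [LHS]big_enum_val.
Qed.

Lemma sub_conv_hull (A : set E) : A `<=` conv_hull A.
Proof.
move=> z Az; exists 1%N, (fun=> z), (fun=> 1); split=> //.
  by rewrite big_ord1.
by rewrite big_ord1 scale1r.
Qed.

(** Some [v i] has a nonzero weight. If that weight is 1, the other terms vanish; otherwise [z] lies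
    strictly between [v i] and another point of the hull, and extremality forces [z = v i]. *)
Lemma extremal_points_conv_hull (A : set E) :
  extremal_points (conv_hull A) `<=` A.
Proof.
move=> z [[m [v [t [vA t0 t1 zE]]]] zext].
have [i ti] : exists i, t i != 0.
  apply/existsP; apply: contraT => /existsPn t_eq0.
  move: t1; rewrite big1 => [/esym/eqP|i _]; first by rewrite oner_eq0.
  by apply/eqP; have := t_eq0 i; rewrite negbK.
have rest : \sum_(j < m | j != i) t j = 1 - t i.
  by rewrite -t1 [in RHS](bigD1 i) //= addrAC subrr add0r.
have ti_le1 : t i <= 1 by rewrite -subr_ge0 -rest sumr_ge0.
have [ti1|ti_neq1] := eqVneq (t i) 1.
  suff -> : z = v i by [].
  rewrite zE (bigD1 i) //= ti1 scale1r big1 ?addr0 // => j ji.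
  suff -> : t j = 0 by rewrite scale0r.
  move: rest; rewrite ti1 subrr => /eqP; rewrite psumr_eq0 //.
  by move=> /allP/(_ j); rewrite mem_index_enum ji => /(_ isT)/eqP.
have ti_lt1 : t i < 1 by rewrite lt_neqAle ti_neq1.
have ti_gt0 : 0 < t i by rewrite lt_neqAle eq_sym ti t0.
have s_neq0 : 1 - t i != 0 by rewrite subr_eq0 eq_sym.
(* The remaining terms, renormalised to total weight 1. *)
pose y := \sum_(j in predC1 i) (t j / (1 - t i)) *: v j.
have yA : conv_hull A y.
  apply: conv_hull_fin => [j _|j _|]; first exact: vA.
    by rewrite divr_ge0 // subr_ge0.
  by rewrite -mulr_suml rest divff.
have [||<- _] := zext (v i) y (t i) (sub_conv_hull A _ (vA i)) yA; last exact: vA.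
  by rewrite ti_gt0.
rewrite zE (bigD1 i) //= scaler_sumr; congr (_ + _).
by apply: eq_bigr => j _; rewrite scalerA mulrCA divff // mulr1.
Qed.

End ConvexHull.

(** * Level sums and the product of simplices *)

Section SumLaw.
Context {R : realType} {d : nat}.
Implicit Types (f : {ffun binvec d -> R^o}) (c : {ffun 'I_d.+1 -> binvec d}).
Implicit Types (x : binvec d) (k : 'I_d.+1).

Definition level x : 'I_d.+1 := Ordinal (weight_leq x : (weight x < d.+1)%N).

Lemma bin_ord_gt0 k : (0 < 'C(d, k))%N.
Proof. by rewrite bin_gt0 -ltnS. Qed.

Lemma weight_level_pt k j : (j < 'C(d, k))%N -> weight (level_pt d k j) = k.
Proof.
by move=> jk; apply/eqP; rewrite -mem_level_seq mem_nth // size_level_seq.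
Qed.

Lemma index_level_lt k x : weight x = k -> (index x (level_seq d k) < 'C(d, k))%N.
Proof. by move=> xk; rewrite -size_level_seq index_mem mem_level_seq xk. Qed.

Lemma level_pt_index k x :
  weight x = k -> level_pt d k (index x (level_seq d k)) = x.
Proof. by move=> xk; rewrite /level_pt nth_index // mem_level_seq xk. Qed.

Lemma sum_level_blocks f k :
  \sum_j blocks f k 0 j = \sum_(x | weight x == k) f x.
Proof.
transitivity (\sum_(x <- level_seq d k) f x).
  rewrite (big_nth (nseq_tuple d false)) size_level_seq big_mkord.
  by rewrite -[in RHS](bin_predK k); apply: eq_bigr => j _; rewrite mxE.
rewrite (perm_big _ (permEl (perm_sort _ _))) big_enum /=.
by apply: eq_bigl => x; rewrite inE.
Qed.

Context {p : {ffun 'I_d.+1 -> R^o}} (hp : pmfs p).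

(** Total mass 1 follows from the level sums: the levels partition the cube and [p] itself sums to
    1. *)
Lemma pmfs_with_sumP f : pmfs_with_sum p f <->
  (forall x, 0 <= f x) /\ forall k, \sum_(x | weight x == k) f x = p k.
Proof.
split=> [[[f0 _] fp]|[f0 fp]].
  by split=> // k; rewrite -fp ffunE.
split; last by apply/ffunP => k; rewrite ffunE fp.
split=> //; rewrite (partition_big level predT) //=.
by rewrite -hp.2; apply: eq_bigr => k _; rewrite -fp.
Qed.

Lemma blocks_pmfs_with_sum f : pmfs_with_sum p f <-> simplex_prod p (blocks f).
Proof.
rewrite pmfs_with_sumP; split=> [[f0 fp] k|fp].
  by split=> [j|]; [rewrite mxE|rewrite sum_level_blocks].
split=> [x|k]; last by rewrite -sum_level_blocks (fp k).2.
have lt_x := index_level_lt (level x) x erefl.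
(* The column index must be bounded by ['C(d, k).-1.+1], the syntactic length of the block. *)
rewrite -(bin_predK (level x)) in lt_x.
by have := (fp (level x)).1 (Ordinal lt_x); rewrite mxE level_pt_index.
Qed.

Lemma pmfs_with_sum_conv : conv_hull (pmfs_with_sum p) `<=` pmfs_with_sum p.
Proof.
move=> f [m [v [t [vP t0 t1 ->]]]]; apply/pmfs_with_sumP; split=> [x|k].
  rewrite sum_ffunE sumr_ge0 // => i _; rewrite ffunE mulr_ge0 //.
  by have /pmfs_with_sumP[] := vP i.
under eq_bigr do rewrite sum_ffunE.
rewrite exchange_big -[RHS]mul1r -t1 mulr_suml; apply: eq_bigr => i _ /=.
under eq_bigr do rewrite ffunE.
by rewrite -mulr_sumr; have /pmfs_with_sumP[_ ->] := vP i.
Qed.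

(** * Selections of one point per level, and their vertices *)

Definition selections : {pred {ffun 'I_d.+1 -> binvec d}} :=
  family (fun k => [pred x | weight x == k]).

(** A selection stores the chosen points rather than their ranks in [level_seq], so selections live
    in a finite type of non-dependent functions; reading off [level x] replaces the search for [k]
    in [extremal_pmf]. *)
Definition vertex c : {ffun binvec d -> R^o} :=
  [ffun x => if c (level x) == x then p (level x) else 0].

Lemma selectionsP c : reflect (forall k, weight (c k) = k) (c \in selections).
Proof.
by apply: (iffP familyP) => cP k; [apply/eqP/cP | rewrite inE cP].
Qed.

(** Distributivity: expanding the product of level sums chooses one point in each level. For laws on
    the levels, this gives the total mass and the marginals of independent selection. *)
Lemma sum_selections (u : 'I_d.+1 -> binvec d -> R) :
  \sum_(c in selections) \prod_k u k (c k) =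
  \prod_(k < d.+1) \sum_(x | weight x == k) u k x.
Proof. by rewrite [RHS]bigA_distr_big_dep. Qed.

Lemma level_selection c k : c \in selections -> level (c k) = k.
Proof. by move=> /selectionsP cP; apply: val_inj; rewrite /= cP. Qed.

Lemma extremal_pmf_vertex (s : forall k : 'I_d.+1, 'I_('C(d, k))) :
  extremal_pmf p s = vertex [ffun k : 'I_d.+1 => level_pt d k (s k)].
Proof.
apply/ffunP => x; rewrite !ffunE; case: pickP => [k /eqP xE|xN].
  have -> : level x = k by apply: val_inj; rewrite /= xE weight_level_pt.
  by rewrite -xE eqxx.
by rewrite eq_sym xN.
Qed.

Lemma extremal_pmfs_vertices :
  [set f | exists s, f = extremal_pmf p s] =
  [set vertex c | c in [set` selections]].
Proof.
apply/seteqP; split=> [f [s ->]|_ [c cP <-]] /=.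
  exists [ffun k : 'I_d.+1 => level_pt d k (s k)]; last by rewrite extremal_pmf_vertex.
  by apply/selectionsP => k; rewrite ffunE weight_level_pt.
have /selectionsP cW : c \in selections by [].
exists (fun k => Ordinal (index_level_lt k (c k) (cW k))).
rewrite extremal_pmf_vertex; congr vertex; apply/ffunP => k.
by rewrite ffunE /= level_pt_index.
Qed.

Lemma vertex_in c : c \in selections -> pmfs_with_sum p (vertex c).
Proof.
move=> cS; apply/pmfs_with_sumP; split=> [x|k].
  by rewrite ffunE; case: ifP => // _; apply: hp.1.
rewrite (bigD1 (c k)) /=; last by have /selectionsP -> := cS.
rewrite ffunE level_selection // eqxx big1 ?addr0 // => x /andP[/eqP xk xc].
have -> : vertex c x = if c (level x) == x then p (level x) else 0.
  by rewrite ffunE.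
have -> : level x = k by apply: val_inj.
by rewrite eq_sym (negbTE xc).
Qed.

(* Where p_k = 0 the level carries no mass, so any law on it will do. *)
Lemma level_weights f : pmfs_with_sum p f ->
  exists w : 'I_d.+1 -> binvec d -> R,
    [/\ forall k x, 0 <= w k x, forall k, \sum_(x | weight x == k) w k x = 1
      & forall x, p (level x) * w (level x) x = f x].
Proof.
move=> /pmfs_with_sumP[f0 fp].
exists (fun k x => if p k == 0 then (x == level_pt d k 0)%:R else f x / p k).
split=> [k x|k|x].
- by case: ifP => _; rewrite ?ler0n // divr_ge0 //; apply: hp.1.
- have [pk0|pk0] := eqVneq (p k) 0; last by rewrite -mulr_suml fp divff.
  rewrite (bigD1 (level_pt d k 0)) /=.
    by rewrite eqxx big1 ?addr0 // => x /andP[_ /negbTE ->].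
  by rewrite weight_level_pt // bin_ord_gt0.
- have [px0|px0] := eqVneq (p (level x)) 0; last by rewrite mulrC divfK.
  rewrite px0 mul0r; apply/esym/eqP.
  have /eqP := fp (level x); rewrite px0 psumr_eq0 //.
  by move=> /allP/(_ x); rewrite mem_index_enum eqxx => /(_ isT).
Qed.

Lemma pmfs_with_sum_conv_vertices :
  pmfs_with_sum p = conv_hull [set vertex c | c in [set` selections]].
Proof.
apply/seteqP; split=> [f /level_weights[w [w0 w1 wf]]|f]; last first.
  move=> [m [v [t [vV t0 t1 ->]]]]; apply: pmfs_with_sum_conv.
  by exists m, v, t; split=> // i; have [c cS <-] := vV i; apply: vertex_in.
pose t (c : {ffun 'I_d.+1 -> binvec d}) := \prod_k w k (c k).
suff -> : f = \sum_(c in selections) t c *: vertex c.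
  apply: conv_hull_fin => [c cS|c _|]; first by exists c.
    exact: prodr_ge0.
  by rewrite sum_selections big1.
apply/ffunP => x; rewrite sum_ffunE -wf.
(* Conditioning on the selection passing through [x]: the product of the [u k (c k)] is [t c] if [c]
   selects [x] and 0 otherwise. Its sum over [c] factors into [w (level x) x] times level sums equal
   to 1. *)
pose u k y := if (k == level x) && (y != x) then 0 else w k y.
transitivity (p (level x) * \sum_(c in selections) \prod_k u k (c k)).
  rewrite sum_selections (bigD1 (level x)) //=.
  rewrite [X in _ = _ * (_ * X)]big1 => [|k kx].
    rewrite mulr1; congr (_ * _); rewrite (bigD1 x) //= /u !eqxx /=.
    by rewrite big1 ?addr0 // => y /andP[_ ->].
  by rewrite -[RHS](w1 k); apply: eq_bigr => y _; rewrite /u (negbTE kx).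
rewrite mulr_sumr; apply: eq_bigr => c _; rewrite !ffunE mulrC.
have [cx|cx] := eqVneq (c (level x)) x.
  congr (_ * _); apply: eq_bigr => k _; rewrite /u.
  by case: eqVneq => //= ->; rewrite cx eqxx.
by rewrite (bigD1 (level x)) //= /u eqxx cx /= mul0r mul0r scaler0.
Qed.

(** In each level only the selected point can carry mass, so it carries the whole level sum
    [p k]. *)
Lemma pmfs_with_sum_vertex_unique f c : c \in selections -> pmfs_with_sum p f ->
  (forall x, vertex c x = 0 -> f x = 0) -> f = vertex c.
Proof.
move=> cS /pmfs_with_sumP[_ fp] f0; apply/ffunP => x.
have [cx|cx] := eqVneq (c (level x)) x; last first.
  by rewrite ffunE (negbTE cx) f0 // ffunE (negbTE cx).
rewrite ffunE cx eqxx -fp (bigD1 x) //= big1 ?addr0 // => y /andP[/eqP yx ynx].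
apply: f0; rewrite ffunE.
have -> : level y = level x by apply: val_inj.
by rewrite cx eq_sym (negbTE ynx).
Qed.

Lemma vertex_extremal c :
  c \in selections -> extremal_points (pmfs_with_sum p) (vertex c).
Proof.
move=> cS; split; first exact: vertex_in.
move=> f g t fP gP /andP[t0 t1] fgE.
have s0 : 0 < 1 - t by rewrite subr_gt0.
have [f0 _] := (pmfs_with_sumP f).1 fP; have [g0 _] := (pmfs_with_sumP g).1 gP.
(* Where the vertex vanishes, a combination of nonnegative values with positive coefficients is
   zero, so both values are zero. *)
have fg0 x : vertex c x = 0 -> f x = 0 /\ g x = 0.
  rewrite fgE !ffunE => /eqP; rewrite paddr_eq0 ?mulr_ge0 ?(ltW t0) ?(ltW s0) //.
  by rewrite !mulf_eq0 (gt_eqF t0) (gt_eqF s0) /= => /andP[/eqP -> /eqP ->].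
by split; apply: pmfs_with_sum_vertex_unique => // x /fg0[].
Qed.

End SumLaw.

Theorem theorem2p1 (R : realType) (d : nat) (hd : (1 <= d)%N)
    (p : {ffun 'I_d.+1 -> R^o}) (hp : pmfs p) :
  [/\ convex_polytope (pmfs_with_sum p),
      @blocks R d @` pmfs_with_sum p = simplex_prod p
    & extremal_points (pmfs_with_sum p) =
      [set f | exists s : forall k : 'I_d.+1, 'I_('C(d, k)),
                 f = extremal_pmf p s]].
Proof.
have hullE := pmfs_with_sum_conv_vertices hp.
split.
- exists [set vertex (p := p) c | c in [set` selections]] => //.
  by apply: finite_image; apply: finite_finset.
- apply/seteqP; split=> [_ [f fP <-]|y yP].
    exact/(blocks_pmfs_with_sum hp).
  have [g _ gK] := blocks_bij R d.
  by exists (g y); rewrite ?gK //; apply/(blocks_pmfs_with_sum hp); rewrite gK.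
- rewrite extremal_pmfs_vertices; apply/seteqP; split=> [f|_ [c cS <-]].
    by rewrite hullE => /extremal_points_conv_hull.
  exact: vertex_extremal.
Qed.
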